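(* Let $\mathcal{H}$ be a separable Hilbert space and let $\mathcal{F}$ be a linearly independent overcomplete frame of $\mathcal{H}$ with frame-operator $S$ such that (i) $\mathcal{F}=\bigcup_{k\in\mathbb{Z}}\mathcal{F}_k$ is an infinite disjoint union of non-empty subsets $\mathcal{F}_k$; (ii) $\langle f,S^{-1}f'\rangle=0$ for all $f\in\mathcal{F}_{k_1}$ and $f'\in\mathcal{F}_{k_2}$ with $k_1\ne k_2$. Then, regardless of the ordering over $\mathbb{Z}$, $\mathcal{F}$ is not generated by an operator in $GL(\mathcal{H})$; that is, for every enumeration (bijection) $n\mapsto f_n$ of $\mathcal{F}$ by $\mathbb{Z}$ there is no $T\in GL(\mathcal{H})$ with $f_n=T^nf_0$ for all $n\in\mathbb{Z}$.
   Context: A countable family $\mathcal{F}$ in a (complex) separable Hilbert space $\mathcal{H}$ is a frame if there exist $A,B>0$ with $A\|f\|^2\le\sum_{u\in\mathcal{F}}|\langle f,u\rangle|^2\le B\|f\|^2$ for all $f\in\mathcal{H}$. Its frame-operator is $Sf=\sum_{u\in\mathcal{F}}\langle f,u\rangle u$, a bounded, positive, self-adjoint bijection of $\mathcal{H}$. Its synthesis operator is $U:\ell_2(\mathcal{F})\to\mathcal{H}$, $U\{c_u\}=\sum_{u\in\mathcal{F}}c_uu$. A frame is a Riesz basis if $\ker U=\{0\}$, and is overcomplete if it is not a Riesz basis. $GL(\mathcal{H})$ is the set of bounded linear bijective operators $T:\mathcal{H}\to\mathcal{H}$ (hence with bounded inverse). Linear independence means that every finite subfamily is linearly independent. *)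

(* Defs.v *)
From HB Require Import structures.
From mathcomp Require Import all_boot all_order all_algebra finmap complex.
From mathcomp Require Import all_classical all_reals all_analysis.
From mathcomp Require Import summability.

Set Implicit Arguments.
Unset Strict Implicit.
Unset Printing Implicit Defensive.

Import Order.TTheory GRing.Theory Num.Theory.
Import numFieldNormedType.Exports.

Local Open Scope classical_set_scope.
Local Open Scope ring_scope.

Definition separable_space (X : topologicalType) : Prop :=
  exists D : set X, countable D /\ dense D.

(* Over the scalars R[i], norms take values in R[i]; they are real there, and
   [sqnorm] is the squared norm (or squared modulus) as an element of R. *)
Definition sqnorm (R : realType) (V : normedZmodType R[i]) (x : V) : R :=
  complex.Re (`|x| ^+ 2).

(* For a bijective T this is the two-sided inverse of T; points outside the
   range of T, if any, are sent to 0. *)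
Definition inverse (V : zmodType) (T : V -> V) : V -> V :=
  'pinv_(fun=> 0) [set: V] T.

Definition zpower (V : zmodType) (T : V -> V) (n : int) : V -> V :=
  match n with
  | Posz k => iter k T
  | Negz k => iter k.+1 (inverse T)
  end.

Definition GL (R : realType) (H : completeNormedModType R[i])
    (T : {linear H -> H}) : Prop :=
  (exists M : R[i], forall x : H, `|T x| <= M * `|x|) /\ bijective T.

Definition lin_indep (K : fieldType) (V : lmodType K) (F : set V) : Prop :=
  forall A : {fset V}, [set` A] `<=` F ->
  forall c : V -> K, \sum_(u <- A) c u *: u = 0 ->
  forall u, u \in A -> c u = 0.

(* The inner product [dot] is linear in its first argument.  The index type [F]
   in sums and coefficient families is the subtype of elements of the set F,
   and [summability.sum] is the limit of the finite partial sums along the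
   directed set of finite subsets of the index type. *)
Section Frames.
Variables (R : realType) (H : completeNormedModType R[i]).
Variable dot : {dot H for @Num.Def.conjC R[i]}.

Definition is_frame (F : set H) : Prop :=
  countable F /\
  exists A B : R, [/\ 0 < A, 0 < B & forall f : H,
    ((A * sqnorm f)%:E <= \esum_(u in F) (sqnorm (dot f u))%:E)%E /\
    (\esum_(u in F) (sqnorm (dot f u))%:E <= (B * sqnorm f)%:E)%E].

Definition frame_operator (F : set H) (f : H) : H :=
  summability.sum (fun u : F => dot f (val u) *: val u).

Definition ell2 (I : choiceType) (c : I -> R[i]) : Prop :=
  (\esum_(u in [set: I]) (sqnorm (c u))%:E < +oo)%E.

Definition synthesis (F : set H) (c : F -> R[i]) : H :=
  summability.sum (fun u : F => c u *: val u).

Definition is_riesz_basis (F : set H) : Prop :=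
  is_frame F /\
  forall c : F -> R[i], ell2 c -> synthesis c = 0 -> forall u, c u = 0.

Definition is_overcomplete_frame (F : set H) : Prop :=
  is_frame F /\ ~ is_riesz_basis F.

End Frames.

(* Main.v *)
Require Import Defs.
From HB Require Import structures.
From mathcomp Require Import all_boot all_order all_algebra finmap complex.
From mathcomp Require Import all_classical all_reals all_analysis.
From mathcomp Require Import summability ring lra.

(** Let S be the frame operator and w its inverse.  The numbers <f, w f'>, for
    f and f' in the frame, form the Gram matrix of the orthogonal projection
    of l2 onto the complement of the kernel of the synthesis operator U.

    Suppose that f_n = T^n f_0 with T bounded and bijective.  Then the kernel
    of U is invariant under the two-sided shift of the index, so the projection
    commutes with the shift and <f_m, w f_n> depends only on n - m.  Concretely,
    for f in the frame, the coefficient families u |-> <w f, u> and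
    u |-> <w (T f), T u> both synthesize f and are both orthogonal to the
    kernel of U, hence they coincide ([frame_coef_shift]).

    Elements of two different blocks F_k are orthogonal for this matrix.  If
    <f_m, w f_n> were nonzero for some m <> n, then, with d = n - m, every f_j
    would be in the same block as f_(j+d): the block number would be a
    d-periodic function of j, with at most |d| values
    ([periodic_not_surjective]), although there are infinitely many nonempty
    blocks.  So the matrix is diagonal.

    Then f_n = S (w f_n) = <w f_n, f_n> f_n, and f_n is nonzero by linear
    independence, so (f_n) and (w f_n) are biorthogonal.  Pairing a vanishing
    series sum_n c_n f_n with w f_m gives c_m = 0: the frame is a Riesz basis
    ([orthogonal_dual_riesz]), which contradicts overcompleteness.

    All of this uses S (w f) = f, that is, the surjectivity of S.  It follows
    from the lower frame bound, which makes S coercive, by a contraction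
    argument ([coercive_surjective]). *)

Set Implicit Arguments.
Unset Strict Implicit.
Unset Printing Implicit Defensive.

Import Order.TTheory GRing.Theory Num.Theory.
Import numFieldNormedType.Exports.

Local Open Scope classical_set_scope.
Local Open Scope ring_scope.

(** * Squared norms over the complex numbers *)

Section SquaredNorm.
Variables (R : realType) (V : normedZmodType R[i]).
Implicit Types x y : V.

Lemma sqnormE x : `|x| ^+ 2 = (sqnorm x)%:C%C.
Proof.
have /complex_realP[k kE] : `|x| ^+ 2 \is Num.real by rewrite realX// normr_real.
by rewrite /sqnorm kE.
Qed.

Lemma sqnorm_ge0 x : 0 <= sqnorm x.
Proof. by rewrite -ler0c -sqnormE exprn_ge0. Qed.

Lemma sqnorm_eq0 x : sqnorm x = 0 -> x = 0.
Proof.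
move=> x0; apply/eqP; rewrite -normr_eq0 -[_ == 0]andTb -(expf_eq0 _ 2).
by rewrite sqnormE x0.
Qed.

(** Norms live in [R[i]], whose order is partial; estimates are carried out on
    their squares in the real field, and come back through this lemma. *)
Lemma normr_leC x (c : R) : 0 <= c -> sqnorm x <= c ^+ 2 -> `|x| <= c%:C%C.
Proof.
move=> c0 xc; rewrite -(@ler_pXn2r _ 2)// ?nnegrE ?ler0c//.
by rewrite sqnormE -rmorphXn lecR.
Qed.

Lemma sqnorm_le x (c : R) : `|x| <= c%:C%C -> sqnorm x <= c ^+ 2.
Proof.
move=> xc; rewrite -lecR -sqnormE rmorphXn/=.
by rewrite ler_pXn2r// nnegrE// (le_trans _ xc).
Qed.

End SquaredNorm.

Lemma sqnorm_complexE (R : realType) (z : R[i]) :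
  sqnorm z = complex.Re z ^+ 2 + complex.Im z ^+ 2.
Proof. by apply: complexI; rewrite -sqnormE add_Re2_Im2. Qed.

Lemma sqnormC (R : realType) (z : R[i]) : sqnorm z^* = sqnorm z.
Proof. by rewrite /sqnorm norm_conjC. Qed.

Lemma sqnormZ (R : realType) (V : normedModType R[i]) (a : R[i]) (x : V) :
  sqnorm (a *: x) = sqnorm a * sqnorm x.
Proof.
by apply: complexI; rewrite -sqnormE normrZ exprMn !sqnormE rmorphM.
Qed.

Lemma sqnormZ_real (R : realType) (V : normedModType R[i]) (r : R) (x : V) :
  sqnorm (r%:C%C *: x) = r ^+ 2 * sqnorm x.
Proof.
rewrite sqnormZ; congr (_ * _).
apply: etrans (sqnorm_complexE r%:C%C) _.
by rewrite /= expr0n addr0.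
Qed.

Lemma Re_conj (R : realType) (z : R[i]) : complex.Re z^* = complex.Re z.
Proof. by case: z. Qed.

(** The weight [t] is chosen in [bessel_synthesis] as the Bessel bound, so that
    the sum of the second terms is exactly what can be absorbed there. *)
Lemma Re_le_AMGM (R : realType) (a b : R[i]) (t : R) : 0 < t ->
  complex.Re (a * b) <= (t * sqnorm a + t^-1 * sqnorm b) / 2.
Proof.
move=> t0; rewrite !sqnorm_complexE; case: a b => [a1 a2] [b1 b2] /=.
have := sqr_ge0 (t * a1 - b1); have := sqr_ge0 (t * a2 + b2) => h1 h2.
rewrite ler_pdivlMr// -subr_ge0.
suff -> : t * (a1 ^+ 2 + a2 ^+ 2) + t^-1 * (b1 ^+ 2 + b2 ^+ 2) -
    (a1 * b1 - a2 * b2) * 2 = t^-1 * ((t * a1 - b1) ^+ 2 + (t * a2 + b2) ^+ 2).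
  by rewrite mulr_ge0 ?addr_ge0// invr_ge0 ltW.
by field; rewrite gt_eqF.
Qed.

(** * Unordered sums *)

#[local] Existing Instance totally_filter.

Section UnorderedSum.
Variables (K : numFieldType) (V : normedModType K) (I : choiceType).
Implicit Types (v w : I -> V) (x y : V).

Definition has_sum v x := partial_sum v @ totally --> x.

Lemma partial_sumE v (X : {fset I}) : partial_sum v X = \sum_(i <- X) v i.
Proof. by rewrite /partial_sum (big_seq_fsetE _ X predT v). Qed.

Lemma has_sumP v x : has_sum v x <-> forall e : K, 0 < e ->
  exists X : {fset I}, forall Y : {fset I}, (X `<=` Y)%fset ->
    `|x - \sum_(i <- Y) v i| <= e.
Proof.
split => [/cvgrPdist_le h e /h[X _ XY]|h].
  by exists X => Y /XY; rewrite partial_sumE.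
apply/cvgrPdist_le => e /h[X XY]; exists X => // Y /XY.
by rewrite partial_sumE.
Qed.

Lemma has_sum_unique v x y : has_sum v x -> has_sum v y -> x = y.
Proof. by move=> vx vy; exact: (cvg_unique (@norm_hausdorff _ V) vx vy). Qed.

Lemma sum_has_sum v x : has_sum v x -> has_sum v (summability.sum v).
Proof.
by move=> vx; rewrite /summability.sum (cvg_lim (@norm_hausdorff _ V) vx).
Qed.

Lemma has_sumB v w x y : has_sum v x -> has_sum w y ->
  has_sum (fun i => v i - w i) (x - y).
Proof.
rewrite /has_sum => vx wy.
suff -> : partial_sum (fun i => v i - w i) = partial_sum v \- partial_sum w.
  exact: cvgB.
by apply/funext => X; rewrite /= !partial_sumE sumrB.
Qed.

Lemma has_sum_single v j : (forall i, i != j -> v i = 0) -> has_sum v (v j).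
Proof.
move=> v0; apply: cvg_near_cst; exists [fset j]%fset => // X /= jX.
rewrite partial_sumE -(big_fset_incl _ jX) ?big_seq_fset1// => i _.
by rewrite inE => /v0.
Qed.

Lemma has_sum_reindex v x (s : I -> I) :
  injective s -> (forall i, exists j, s j = i) -> has_sum v x -> has_sum (v \o s) x.
Proof.
move=> si /choice[t ts] /has_sumP h; apply/has_sumP => e /h[X XY].
exists (t @` X)%fset => Y tXY.
have -> : \sum_(i <- Y) (v \o s) i = \sum_(i <- (s @` Y)%fset) v i.
  by rewrite big_imfset//= => i j _ _ /si.
apply: XY; apply/fsubsetP => i iX; rewrite -(ts i) in_imfset//=.
by apply: (fsubsetP tXY); exact: in_imfset.
Qed.

Lemma has_sum_norm_le v x (M : K) : has_sum v x ->
  (forall X : {fset I}, `|\sum_(i <- X) v i| <= M) -> `|x| <= M.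
Proof.
move=> /has_sumP vx vM; apply/ler_addgt0Pr => e /vx[X /(_ X (fsubset_refl _)) xX].
rewrite -(subrK (\sum_(i <- X) v i) x) addrC.
by apply: (le_trans (ler_normD _ _)); rewrite lerD.
Qed.

End UnorderedSum.

(** The constant [M] is an arbitrary scalar: it is nonnegative as soon as some
    [y] is nonzero, and replacing it by [`|M| + 1] makes it invertible. *)
Lemma has_sum_map (K : numFieldType) (V W : normedModType K) (I : choiceType)
    (f : {additive V -> W}) (M : K) (v : I -> V) (x : V) :
  (forall y, `|f y| <= M * `|y|) -> has_sum v x -> has_sum (f \o v) (f x).
Proof.
move=> fM /has_sumP vx; apply/has_sumP => e e0.
have M0 : 0 < `|M| + 1 by rewrite ltr_wpDl.
have [X XY] := vx (e / (`|M| + 1)) (divr_gt0 e0 M0).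
exists X => Y /XY; rewrite -raddf_sum -raddfB ler_pdivlMr// mulrC => h.
apply: le_trans h; apply: (le_trans (fM _)).
have [->|/eqP y0] := pselect (x - \sum_(i <- Y) v i = 0).
  by rewrite normr0 !mulr0.
rewrite ler_pM2r ?normr_gt0//.
have := fM (x - \sum_(i <- Y) v i).
move=> /(le_trans (normr_ge0 _)); rewrite pmulr_lge0 ?normr_gt0// => /ger0_norm ->.
by rewrite lerDl.
Qed.

Lemma has_sum_linear (K : numFieldType) (V W : normedModType K) (I : choiceType)
    (f : {linear V -> W}) (M : K) (c : I -> K) (e : I -> V) (x : V) :
  (forall y, `|f y| <= M * `|y|) -> has_sum (fun i => c i *: e i) x ->
  has_sum (fun i => c i *: f (e i)) (f x).
Proof.
move=> fM /(has_sum_map (f := f) fM); congr has_sum.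
by apply/funext => i; rewrite /= linearZ.
Qed.

(** * Inner product *)

Section InnerProduct.
Variables (R : realType) (H : completeNormedModType R[i]).
Variable dot : {dot H for @Num.Def.conjC R[i]}.
Hypothesis dotE : forall x : H, dot x x = `|x| ^+ 2.
Implicit Types x y : H.

Lemma dotC x y : dot x y = (dot y x)^*.
Proof. by rewrite hermC expr0 mul1r. Qed.

Lemma sqnorm_dotC x y : sqnorm (dot x y) = sqnorm (dot y x).
Proof. by rewrite dotC sqnormC. Qed.

Lemma dot_sqnorm x : dot x x = (sqnorm x)%:C%C.
Proof. by rewrite dotE sqnormE. Qed.

Lemma sqnormB_dot x y :
  sqnorm (x - y) = sqnorm x + sqnorm y - 2 * complex.Re (dot x y).
Proof.
apply: complexI; rewrite -dot_sqnorm dnormB.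
by rewrite !dot_sqnorm addcJ rmorphB rmorphD rmorphM rmorph_nat.
Qed.

(** Expand the squared norm of |y|^2 x - <x, y> y, which is |y|^2 times the
    difference of the two sides. *)
Lemma Cauchy_Schwarz x y : sqnorm (dot x y) <= sqnorm x * sqnorm y.
Proof.
have [->|/eqP y0] := pselect (y = 0).
  by rewrite linear0r /sqnorm !normr0 expr0n/= mulr0.
have yp : 0 < sqnorm y.
  rewrite lt_neqAle sqnorm_ge0 andbT eq_sym.
  by apply/eqP => /sqnorm_eq0/eqP; exact/negP.
have := sqnorm_ge0 ((sqnorm y)%:C%C *: x - dot x y *: y).
rewrite sqnormB_dot sqnormZ_real sqnormZ (linearZl_LR dot) (linearZr_LR dot)/=.
rewrite (_ : complex.Re _ = sqnorm y * sqnorm (dot x y)); last first.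
  rewrite [X in complex.Re (_ * X)](_ : _ = (sqnorm (dot x y))%:C%C); last first.
    by rewrite -sqnormE normCKC.
  by rewrite -rmorphM.
move=> h; rewrite -(ler_pM2l yp) -subr_ge0; apply: le_trans h _.
by rewrite le_eqVlt; apply/orP; left; apply/eqP; ring.
Qed.

Lemma norm_dot_le x y : `|dot x y| <= `|y| * `|x|.
Proof.
rewrite -(@ler_pXn2r _ 2)// ?nnegrE ?mulr_ge0//.
by rewrite exprMn !sqnormE -rmorphM lecR mulrC Cauchy_Schwarz.
Qed.

Lemma has_sum_dotl (I : choiceType) (v : I -> H) x y :
  has_sum v x -> has_sum (fun i => dot (v i) y) (dot x y).
Proof.
move=> vx; have := has_sum_map (f := applyr dot y) (norm_dot_le^~ y) vx.
exact.
Qed.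

End InnerProduct.

Section NonnegativeSums.
Variables (R : realType) (I : choiceType).

(** With nonnegative terms, the sum over [X] is below all sums over larger
    sets; the real part carries this over to the complex limit [z]. *)
Lemma has_sum_Re_ge (w : I -> R) (z : R[i]) : (forall i, 0 <= w i) ->
  @has_sum R[i] R[i]^o I (fun i => (w i)%:C%C) z ->
  forall X : {fset I}, \sum_(i <- X) w i <= complex.Re z.
Proof.
move=> w0 /has_sumP wz X; apply/ler_addgt0Pr => e e0.
have e0C : 0 < e%:C%C by rewrite ltcR.
have [Y XY] := wz _ e0C.
have := XY _ (fsubsetUr X Y); rewrite -rmorph_sum/= => h.
have := le_trans (normc_ge_Re _) h; rewrite lecR raddfB/= => {}h.
have : \sum_(i <- X) w i <= \sum_(i <- (X `|` Y)%fset) w i.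
  rewrite [leRHS](big_fsetID _ (mem X))/=.
  have -> : [fset i in (X `|` Y)%fset | i \in X]%fset = X.
    by apply/fsetP => i; rewrite !inE/= andbC; case: (i \in X).
  by rewrite lerDl sumr_ge0.
move=> /le_trans; apply; move/ler_normlP: h => [h _].
by rewrite -lerBlDl -opprB.
Qed.

End NonnegativeSums.

(** * Synthesis with a Bessel sequence *)

Section BesselSequence.
Variables (R : realType) (H : completeNormedModType R[i]).
Variable dot : {dot H for @Num.Def.conjC R[i]}.
Hypothesis dotE : forall x : H, dot x x = `|x| ^+ 2.
Variables (I : choiceType) (e : I -> H) (B : R).
Hypothesis B_gt0 : 0 < B.
Hypothesis bessel : forall f (X : {fset I}),
  \sum_(i <- X) sqnorm (dot f (e i)) <= B * sqnorm f.

(** If x is the synthesized vector, |x|^2 is the sum of the c_i <e_i, x>, each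
    at most (B |c_i|^2 + |<x, e_i>|^2 / B) / 2.  By the Bessel inequality the
    second terms add up to at most |x|^2 / 2, which moves to the left. *)
Lemma bessel_synthesis (c : I -> R[i]) (X : {fset I}) :
  sqnorm (\sum_(i <- X) c i *: e i) <= B * \sum_(i <- X) sqnorm (c i).
Proof.
set x := \sum_(i <- X) _.
have xE : sqnorm x = \sum_(i <- X) complex.Re (c i * dot (e i) x).
  have -> : sqnorm x = complex.Re (dot x x) by rewrite dot_sqnorm.
  rewrite {1}/x linear_sumlz !raddf_sum; apply: eq_bigr => i _.
  by rewrite linearZl_LR.
have : sqnorm x <= (B * \sum_(i <- X) sqnorm (c i) + B^-1 * (B * sqnorm x)) / 2.
  rewrite {1}xE; apply: (@le_trans _ _ (\sum_(i <- X)
      (B * sqnorm (c i) + B^-1 * sqnorm (dot x (e i))) / 2)).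
    apply: ler_sum => i _; rewrite (sqnorm_dotC dot x).
    exact: Re_le_AMGM.
  rewrite -mulr_suml ler_pM2r// big_split/= -!mulr_sumr lerD2l.
  by rewrite ler_pM2l ?invr_gt0.
by rewrite mulKf ?gt_eqF// => h; lra.
Qed.

(** A finite set [X] whose partial sum of the |c_i|^2 is nearly the supremum
    leaves little mass outside; by [bessel_synthesis], the partial sums over
    all larger sets are then close to the one over [X]. *)
Lemma square_summable_has_sum (c : I -> R[i]) :
  (exists M : R, forall X : {fset I}, \sum_(i <- X) sqnorm (c i) <= M) ->
  exists x, has_sum (fun i => c i *: e i) x.
Proof.
move=> [M cM]; apply/cvg_ex/cauchy_cvgP/cauchy_exP => eps eps0.
have [r rE] : exists r : R, eps = r%:C%C.
  by have /complex_realP[r] : eps \is Num.real by [exact: gtr0_real|]; exists r.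
have r0 : 0 < r by rewrite -ltcR -rE.
pose E := [set z | exists X : {fset I}, z = \sum_(i <- X) sqnorm (c i)].
have supE : has_sup E.
  by split; [exists (\sum_(i <- fset0) sqnorm (c i)), fset0
            |exists M => _ [X ->]].
(* Mass below r^2 / (4 B) outside of X changes the sum by at most r / 2. *)
have d0 : 0 < (r / 2) ^+ 2 / B by rewrite divr_gt0// exprn_gt0// divr_gt0.
have [_ [X ->] supX] := sup_adherent d0 supE.
exists (\sum_(i <- X) c i *: e i); exists X => // Y /= XY.
rewrite -ball_normE /ball_/= partial_sumE distrC.
have YE (W : zmodType) (F : I -> W) :
    \sum_(i <- Y) F i = \sum_(i <- X) F i + \sum_(i <- (Y `\` X)%fset) F i.
  rewrite (big_fsetID _ (mem X))/=.
  rewrite (_ : [fset i in Y | i \in X]%fset = X); last first.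
    apply/fsetP => i; rewrite !inE/= andbC.
    by case: (boolP (i \in X)) => // /(fsubsetP XY) ->.
  congr (_ + _); apply: eq_fbigl => i.
  by rewrite !inE/= andbC.
rewrite YE addrAC subrr add0r.
have Ysup : \sum_(i <- Y) sqnorm (c i) <= sup E.
  by apply: ub_le_sup; [case: supE|exists Y].
rewrite (le_lt_trans (@normr_leC _ _ _ (r / 2) _ _))//.
- by rewrite divr_ge0// ltW.
- apply: (le_trans (bessel_synthesis _ _)).
  rewrite mulrC -ler_pdivlMr//; rewrite YE in Ysup.
  by move: supX Ysup; lra.
- by rewrite rE ltcR; lra.
Qed.

End BesselSequence.

(** * Coercive operators are surjective *)

Section Contraction.
Variables (R : realType) (V : completeNormedModType R[i]) (g : V -> V) (q : R).
Hypothesis q_ge0 : 0 <= q.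
Hypothesis q_lt1 : q < 1.
Hypothesis g_lip : forall x y, `|g x - g y| <= q%:C%C * `|x - y|.

(** The Banach fixed point theorem, for a space over the complex numbers: the
    Lipschitz constant is real but the norm takes values in [R[i]]. *)
Lemma contraction_fixpoint : exists x, g x = x.
Proof.
pose y n := iter n g 0; pose C := complex.Re `|y 1%N - y 0%N| / (1 - q).
have q1 : 0 < 1 - q by rewrite subr_gt0.
have CE : `|y 1%N - y 0%N| = (C * (1 - q))%:C%C.
  by rewrite /C mulfVK ?gt_eqF// RRe_real// normr_real.
have C0 : 0 <= C.
  by apply: divr_ge0 (ltW q1); rewrite -ler0c RRe_real ?normr_real.
clearbody C.
have step n : `|y n.+1 - y n| <= (C * q ^+ n * (1 - q))%:C%C.
  elim: n => [|n ih]; first by rewrite expr0 mulr1 CE.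
  apply: (le_trans (g_lip _ _)); rewrite exprS.
  apply: (le_trans (ler_wpM2l _ ih)); first by rewrite ler0c.
  by rewrite -rmorphM lecR le_eqVlt; apply/orP; left; apply/eqP; ring.
have dist n k : `|y n - y (n + k)%N| <= (C * q ^+ n * (1 - q ^+ k))%:C%C.
  elim: k => [|k ih]; first by rewrite addn0 !subrr normr0 mulr0.
  apply: (le_trans (ler_distD (y (n + k)%N) _ _)).
  rewrite [X in _ + X]distrC addnS; apply: (le_trans (lerD ih (step _))).
  rewrite -rmorphD lecR le_eqVlt; apply/orP; left; apply/eqP.
  by rewrite exprD exprS; ring.
have small (r : R) : 0 < r -> exists n, C * q ^+ n < r.
  move=> r0.
  have : (fun n => C * q ^+ n) @ \oo --> (0 : R).
    by apply: cvg_geometric; rewrite ger0_norm.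
  move=> /cvgrPdist_lt/(_ _ r0)[N _ /(_ N (leqnn _))] /=.
  rewrite sub0r normrN ger0_norm ?mulr_ge0 ?exprn_ge0// => ?; by exists N.
have cy : cvg (y @ \oo).
  apply/cauchy_cvgP/cauchy_exP => e e0.
  have rE : e = (complex.Re e)%:C%C by rewrite RRe_real// gtr0_real.
  have r0 : 0 < complex.Re e by rewrite -ltcR -rE.
  have [n nr] := small _ r0; exists (y n); exists n => // m /= nm.
  rewrite -ball_normE /ball_/= -(subnKC nm) (le_lt_trans (dist _ _))//.
  rewrite rE ltcR (le_lt_trans _ nr)// ler_piMr ?mulr_ge0 ?exprn_ge0//.
  by rewrite gerBl exprn_ge0.
have {}cy : y n @[n --> \oo] --> lim (y @ \oo) by [].
exists (lim (y @ \oo)); set x := lim _ in cy *.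
have cg : g (y n) @[n --> \oo] --> g x.
  apply/cvgrPdist_le => e e0; move/cvgrPdist_le: (cy) => /(_ _ e0).
  apply: filterS => n xn; apply: (le_trans (g_lip _ _)).
  apply: (le_trans _ xn); rewrite -[leRHS]mul1r ler_wpM2r//.
  by rewrite lecR ltW.
have cg' : g (y n) @[n --> \oo] --> x.
  have -> : (fun n => g (y n)) = (fun n => y n.+1) by [].
  by move: cy; rewrite -cvg_shiftS.
exact: (cvg_unique (@norm_hausdorff _ V) cg cg').
Qed.

End Contraction.

(** The Lax-Milgram argument: a preimage of y is a fixed point of
    x |-> x - t S x + t y, and
    |z - t S z|^2 <= (1 - 2 t A + t^2 D^2) |z|^2 whenever |S z| <= D |z|.
    The choice t = A / D^2 gives the factor 1 - (A / D)^2 < 1. *)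
Lemma coercive_surjective (R : realType) (H : completeNormedModType R[i])
    (dot : {dot H for @Num.Def.conjC R[i]})
    (dotE : forall x : H, dot x x = `|x| ^+ 2)
    (S : H -> H) (A B : R) : {morph S : x y / x - y} -> 0 < A -> 0 < B ->
  (forall x, A * sqnorm x <= complex.Re (dot x (S x))) ->
  (forall x, sqnorm (S x) <= B ^+ 2 * sqnorm x) ->
  forall y, exists x, S x = y.
Proof.
move=> S_B A0 B0 SA SB y.
(* A + B instead of B ensures A / D < 1, so that the factor is nonnegative. *)
pose D := A + B; pose t := A / D ^+ 2.
have D0 : 0 < D by rewrite addr_gt0.
have t0 : 0 < t by rewrite divr_gt0// exprn_gt0.
pose q2 := 1 - (A / D) ^+ 2.
have AD : 0 < A / D < 1 by rewrite divr_gt0// ltr_pdivrMr// mul1r ltrDl.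
have q20 : 0 <= q2 < 1.
  case/andP: AD => AD0 AD1; rewrite /q2 subr_ge0 gtrBl exprn_gt0// andbT.
  by rewrite expr_le1// ?ltW.
have q2E : 1 - 2 * t * A + t ^+ 2 * D ^+ 2 = q2.
  by rewrite /q2 /t; field; rewrite gt_eqF.
pose g x := x - t%:C%C *: S x + t%:C%C *: y.
have [||x y0|x] := @contraction_fixpoint R H g (Num.sqrt q2).
- exact: sqrtr_ge0.
- by rewrite -sqrtr1 ltr_sqrt//; case/andP: q20.
- have -> : g x - g y0 = (x - y0) - t%:C%C *: S (x - y0).
    rewrite /g S_B scalerBr opprD addrACA subrr addr0.
    by rewrite [- (_ - _) in LHS]opprD addrACA -opprD.
  set z := x - y0.
  rewrite -(@ler_pXn2r _ 2)// ?nnegrE ?mulr_ge0 ?ler0c ?sqrtr_ge0//.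
  rewrite exprMn !sqnormE -rmorphXn -rmorphM lecR sqr_sqrtr; last by case/andP: q20.
  rewrite (sqnormB_dot dotE) sqnormZ_real (linearZr_LR dot)/=.
  rewrite (_ : complex.Re _ = t * complex.Re (dot z (S z))); last first.
    by case: (dot z (S z)) => a b; rewrite /= oppr0 mul0r subr0.
  have := SA z; have := SB z; set s := complex.Re _ => h1 h2.
  have h3 : sqnorm (S z) <= D ^+ 2 * sqnorm z.
    apply: (le_trans h1); rewrite ler_wpM2r ?sqnorm_ge0// ler_pXn2r ?nnegrE ?ltW//.
    by rewrite ltrDr.
  rewrite -q2E.
  have h4 : t * (A * sqnorm z) <= t * s by rewrite ler_pM2l.
  have h5 : t ^+ 2 * sqnorm (S z) <= t ^+ 2 * (D ^+ 2 * sqnorm z).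
    by rewrite ler_pM2l// exprn_gt0.
  rewrite (_ : _ * sqnorm z = sqnorm z - 2 * (t * (A * sqnorm z)) +
    t ^+ 2 * (D ^+ 2 * sqnorm z)); last by ring.
  lra.
- rewrite /g -addrA -[X in _ = X]addr0 => /addrI/eqP.
  rewrite addrC subr_eq0 => /eqP ty; exists x.
  apply: (@scalerI _ _ t%:C%C) (esym ty).
  by rewrite eq_complex/= negb_and gt_eqF.
Qed.

(** * The frame operator *)

Lemma esum_fset_le (R : realType) (I : choiceType) (w : I -> R) (M : R) :
  (forall i, 0 <= w i) ->
  (\esum_(i in [set: I]) (w i)%:E <= M%:E)%E <->
  (forall X : {fset I}, \sum_(i <- X) w i <= M).
Proof.
move=> w0; split => [wM X|wM].
  rewrite -lee_fin; apply: le_trans wM; apply: esum_ge.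
  exists [set` X]; first by split => //; exact: finite_fset.
  by rewrite fsbig_finite ?set_fsetK -?sumEFin//; exact: finite_fset.
apply: ge_ereal_sup => _ [X [finX _] <-].
by rewrite fsbig_finite// sumEFin lee_fin.
Qed.

Section Frame.
Variables (R : realType) (H : completeNormedModType R[i]).
Variable dot : {dot H for @Num.Def.conjC R[i]}.
Hypothesis dotE : forall x : H, dot x x = `|x| ^+ 2.
Variable F : set H.

Lemma esum_frame (f : H) : (\esum_(u in F) (sqnorm (dot f u))%:E =
  \esum_(u in [set: F]) (sqnorm (dot f (val u)))%:E)%E.
Proof.
apply: reindex_esum; split.
- by move=> u _; exact: set_mem (valP u).
- by move=> u v _ _; exact: val_inj.
- by move=> u Fu; exists (SigSub (mem_set Fu)).
Qed.

Hypothesis frameF : is_frame dot F.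

(** The frame inequalities bound an extended-real sum over a subset of H,
    whereas the series of vectors are indexed by the subtype of its elements.
    Here both bounds are read on finite partial sums over that subtype. *)
Lemma frame_bounds : exists A B : R, [/\ 0 < A, 0 < B,
  forall (f : H) (X : {fset F}),
    \sum_(u <- X) sqnorm (dot f (val u)) <= B * sqnorm f &
  forall (f : H) (M : R),
    (forall X : {fset F}, \sum_(u <- X) sqnorm (dot f (val u)) <= M) ->
    A * sqnorm f <= M].
Proof.
have [_ [A [B [A0 B0 AB]]]] := frameF; exists A, B; split=> // f.
  apply/esum_fset_le; first by move=> u; exact: sqnorm_ge0.
  by rewrite -esum_frame; have [] := AB f.
move=> M fM; rewrite -lee_fin; have [h _] := AB f; apply: (le_trans h).
by rewrite esum_frame; apply/esum_fset_le => // u; exact: sqnorm_ge0.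
Qed.

Lemma synthesis_has_sum (c : F -> R[i]) :
  (exists M : R, forall X : {fset F}, \sum_(u <- X) sqnorm (c u) <= M) ->
  has_sum (fun u : F => c u *: val u) (synthesis c).
Proof.
have [A [B [A0 B0 FB _]]] := frame_bounds => cM.
by have [x /sum_has_sum] := square_summable_has_sum dotE B0 FB cM.
Qed.

Lemma frame_operator_has_sum (f : H) :
  has_sum (fun u : F => dot f (val u) *: val u) (frame_operator dot F f).
Proof.
apply: synthesis_has_sum; have [A [B [A0 B0 FB _]]] := frame_bounds.
by exists (B * sqnorm f).
Qed.

Lemma frame_operatorB : {morph frame_operator dot F : x y / x - y}.
Proof.
move=> x y /=; have h := @frame_operator_has_sum (x - y); apply: has_sum_unique h _.
have := has_sumB (@frame_operator_has_sum x) (@frame_operator_has_sum y).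
by under eq_fun do rewrite -scalerBl -linearBl.
Qed.

(** The lower frame bound is coercivity of S, as <S x, x> is the sum of the
    |<x, u>|^2; the bound |S x| <= B |x| is the Bessel inequality used once for
    the coefficients <x, u> and once for their synthesis. *)
Lemma frame_operator_surjective y : exists x, frame_operator dot F x = y.
Proof.
have [A [B [A0 B0 FB FA]]] := frame_bounds.
apply: (coercive_surjective dotE frame_operatorB A0 B0) => x.
  have Sxx : has_sum (fun u : F => (sqnorm (dot x (val u)))%:C%C : R[i]^o)
      (dot (frame_operator dot F x) x).
    have := has_sum_dotl dotE (y := x) (@frame_operator_has_sum x).
    under eq_fun do rewrite (linearZl_LR dot)/= [X in _ * X]dotC -normCK sqnormE.
    by [].
  apply: FA; rewrite dotC Re_conj; apply: has_sum_Re_ge Sxx => u.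
  exact: sqnorm_ge0.
rewrite -[leRHS]sqr_sqrtr ?mulr_ge0 ?sqnorm_ge0 ?exprn_ge0 ?(ltW B0)//.
apply: sqnorm_le; apply: has_sum_norm_le (@frame_operator_has_sum x) _ => X.
apply: normr_leC; first exact: sqrtr_ge0.
rewrite sqr_sqrtr ?mulr_ge0 ?sqnorm_ge0 ?exprn_ge0 ?(ltW B0)//.
apply: (le_trans (bessel_synthesis dotE B0 FB _ _)).
by rewrite expr2 -mulrA ler_pM2l.
Qed.

End Frame.

(** * Coefficients of a frame that is invariant under an operator *)

Section ShiftInvariance.
Variables (R : realType) (H : completeNormedModType R[i]).
Variable dot : {dot H for @Num.Def.conjC R[i]}.
Hypothesis dotE : forall x : H, dot x x = `|x| ^+ 2.
Variable F : set H.
Hypothesis frameF : is_frame dot F.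
Variables (T : {linear H -> H}) (M : R[i]).
Hypothesis T_bounded : forall x, `|T x| <= M * `|x|.
Hypothesis T_inj : injective T.
Hypothesis TF : forall u, F u -> F (T u).
Hypothesis TF_surj : forall v, F v -> exists2 u, F u & T u = v.

Let Fmem (u : F) : F (val u) := set_mem (valP u).

(** Think of g = w f and h = w (T f).  The families a_u = <g, u> and
    b_u = <h, T u> have the same synthesis f: for b, the sum converges by the
    Bessel inequality, and its image by T is S h = T f after reindexing the
    frame by T.  So c = a - b satisfies sum_u c_u u = 0, and applying T also
    sum_u c_u T u = 0.  Pairing the first with g and the second with h, and
    subtracting, gives sum_u |c_u|^2 = 0. *)
Lemma frame_coef_shift g h u : F u ->
  T (frame_operator dot F g) = frame_operator dot F h -> dot g u = dot h (T u).
Proof.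
move=> Fu Tgh.
pose s (v : F) : F := SigSub (mem_set (TF (Fmem v))).
have s_inj : injective s by move=> v w /(congr1 val) /= /T_inj/val_inj.
have s_surj v : exists w, s w = v.
  have [w Fw wv] := TF_surj (Fmem v); exists (SigSub (mem_set Fw)).
  exact: val_inj.
have [A [B [A0 B0 FB _]]] := frame_bounds frameF.
pose a (v : F) := dot g (val v); pose b (v : F) := dot h (T (val v)).
have Sh := frame_operator_has_sum dotE frameF (f := h).
have {}Sh := has_sum_reindex s_inj s_surj Sh.
have [z bz] : exists z, has_sum (fun v : F => b v *: val v) z.
  apply: (square_summable_has_sum dotE B0 FB); exists (B * sqnorm h) => X.
  apply: le_trans (FB h (s @` X)%fset).
  by rewrite big_imfset//= => v w _ _ /s_inj.
have zE : z = frame_operator dot F g.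
  apply: T_inj; rewrite Tgh; apply: has_sum_unique Sh.
  exact: has_sum_linear T_bounded bz.
pose c v := a v - b v.
have c0 : has_sum (fun v : F => c v *: val v) 0.
  have := has_sumB (frame_operator_has_sum dotE frameF (f := g)) bz.
  by rewrite zE subrr; under eq_fun do rewrite -scalerBl.
have Tc0 : has_sum (fun v : F => c v *: T (val v)) 0.
  by rewrite -(raddf0 T); exact: has_sum_linear T_bounded c0.
have cc0 : has_sum (fun v : F => (sqnorm (c v))%:C%C : R[i]^o) 0.
  have := has_sumB (has_sum_dotl dotE (y := g) c0) (has_sum_dotl dotE (y := h) Tc0).
  rewrite !linear0l subrr; congr has_sum; apply/funext => v.
  rewrite !(linearZl_LR dot)/= -mulrBr (dotC dot _ g) (dotC dot _ h) -rmorphB.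
  by rewrite -normCK sqnormE.
pose u' : F := SigSub (mem_set Fu).
have := has_sum_Re_ge (fun v => sqnorm_ge0 (c v)) cc0 [fset u']%fset.
rewrite big_seq_fset1 => cu; have /sqnorm_eq0/eqP : sqnorm (c u') = 0.
  by apply/eqP; rewrite eq_le cu sqnorm_ge0.
by rewrite subr_eq0 => /eqP.
Qed.

End ShiftInvariance.

Section Biorthogonal.
Variables (R : realType) (H : completeNormedModType R[i]).
Variable dot : {dot H for @Num.Def.conjC R[i]}.
Hypothesis dotE : forall x : H, dot x x = `|x| ^+ 2.
Variable F : set H.
Hypothesis frameF : is_frame dot F.

(** When the dual family is orthogonal to all other elements of the frame, the
    reconstruction formula for u has a single term, <w u, u> u, which forces
    <w u, u> = 1; pairing with w u then reads off the coefficient at u. *)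
Lemma orthogonal_dual_riesz (w : H -> H) :
  (forall u, F u -> u != 0) ->
  (forall u, F u -> frame_operator dot F (w u) = u) ->
  (forall u v, F u -> F v -> u != v -> dot u (w v) = 0) ->
  is_riesz_basis dot F.
Proof.
move=> F0 wK orth; split => // c /= ell2c c0 u.
have Fmem (v : F) : F (val v) := set_mem (valP v).
have orthF v : v != u -> dot (val v) (w (val u)) = 0.
  by move=> vu; apply: orth (Fmem v) (Fmem u) _; rewrite (inj_eq val_inj).
have cu : has_sum (fun v : F => c v *: val v) 0.
  rewrite -c0; apply: (synthesis_has_sum dotE frameF).
  exists (fine (\esum_(v in [set: F]) (sqnorm (c v))%:E)); apply/esum_fset_le.
    by move=> v; exact: sqnorm_ge0.
  by rewrite fineK// ge0_fin_numE// esum_ge0// => v _; rewrite lee_fin sqnorm_ge0.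
have wu1 : dot (val u) (w (val u)) = 1.
  have := has_sum_single (j := u)
    (v := fun v : F => dot (w (val u)) (val v) *: val v).
  have Su := frame_operator_has_sum dotE frameF (f := w (val u)).
  rewrite wK// in Su.
  move=> /(_ _)/has_sum_unique-/(_ _ _ Su) uE.
  have {}uE : dot (w (val u)) (val u) *: val u = val u.
    by apply: uE => v vu; rewrite dotC orthF// conjC0 scale0r.
  rewrite dotC; suff -> : dot (w (val u)) (val u) = 1 by rewrite conjC1.
  apply/eqP; rewrite -subr_eq0; have : (dot (w (val u)) (val u) - 1) *: val u == 0.
    by rewrite scalerBl scale1r uE subrr.
  by rewrite scaler_eq0 (negPf (F0 _ (Fmem u))) orbF.
have := has_sum_dotl dotE (y := w (val u)) cu.
rewrite linear0l => cw.
have := has_sum_single (j := u)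
  (v := fun v : F => dot (c v *: val v) (w (val u)) : R[i]^o).
move=> /(_ _)/has_sum_unique-/(_ _ _ cw) cE.
have : dot (c u *: val u) (w (val u)) = 0.
  by apply: cE => v vu; rewrite (linearZl_LR dot)/= [dot _ _]orthF// mulr0.
by rewrite (linearZl_LR dot)/= wu1 mulr1.
Qed.

End Biorthogonal.

(** * Orbits indexed by the integers *)

Lemma lin_indep_neq0 (K : fieldType) (V : lmodType K) (F : set V) (u : V) :
  lin_indep F -> F u -> u != 0.
Proof.
move=> F_indep Fu; apply/eqP => u0.
have uF : [set` [fset u]%fset] `<=` F by move=> v /=; rewrite inE => /eqP ->.
have := F_indep _ uF (fun=> 1); rewrite big_seq_fset1 u0 scaler0.
by move=> /(_ erefl u); rewrite u0 inE eqxx => /(_ isT)/eqP; rewrite oner_eq0.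
Qed.

Lemma inverse_surjK (V : zmodType) (f : V -> V) :
  (forall y, exists x, f x = y) -> cancel (inverse f) f.
Proof.
move=> fsurj y; have f_surj : set_surj setT setT f.
  by move=> z _; have [x] := fsurj z; exists x.
by apply: (surjpK _ f_surj); rewrite in_setT.
Qed.

Lemma zpowerS (V : zmodType) (T : V -> V) (n : int) (x : V) :
  cancel (inverse T) T -> T (zpower T n x) = zpower T (n + 1) x.
Proof.
move=> TK; case: n => [k|[|k]].
- by rewrite [_ + 1](_ : _ = k.+1%:Z); last by rewrite intS addrC.
- by rewrite [_ + 1](_ : _ = 0) //= TK.
- rewrite [_ + 1](_ : _ = Negz k); first by rewrite /= TK.
  by rewrite !NegzE intS opprD addrC addrA subrr add0r.
Qed.

Lemma shift_invariantE (A : Type) (c : int -> int -> A) :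
  (forall m n, c (m + 1) (n + 1) = c m n) ->
  forall j m n, c (m + j) (n + j) = c m n.
Proof.
move=> cS; elim/int_rect => [|j ih|j ih] m n; first by rewrite !addr0.
  by rewrite -addn1 PoszD !addrA cS.
by rewrite -cS -addn1 PoszD opprD !addrA !subrK.
Qed.

(** A periodic function is determined by its values on the residues modulo
    [d]; the sum of their absolute values bounds it. *)
Lemma periodic_not_surjective (k : int -> int) (d : int) : d != 0 ->
  (forall j, k (j + d) = k j) -> ~ (forall m, exists j, k j = m).
Proof.
move=> d0 kd ksurj.
have kdn (n : int) : forall j, k (j + n * d) = k j.
  elim/int_rect: n => [|n ih|n ih] j; first by rewrite mul0r addr0.
    by rewrite -addn1 PoszD mulrDl mul1r addrA kd.
  by rewrite -kd -addn1 PoszD opprD mulrDl mulN1r addrA subrK.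
pose M := (\sum_(r < `|d|%N) `|k r|%N)%N.
have [j kj] := ksurj M.+1.
have kjr : k j = k (j %% d)%Z.
  by rewrite [in LHS](divz_eq j d) addrC kdn.
have [r rE] : exists r : nat, (j %% d)%Z = r.
  by exists `|(j %% d)%Z|%N; rewrite gez0_abs ?modz_ge0.
have rd : (r < `|d|%N)%N by rewrite -ltz_nat -rE ltz_mod.
have : (`|k r| <= M)%N by rewrite /M (bigD1 (Ordinal rd))//= leq_addr.
by rewrite -rE -kjr kj ltnn.
Qed.

Theorem theorem3p1 (R : realType) (H : completeNormedModType R[i])
    (dot : {dot H for @Num.Def.conjC R[i]})
    (dotE : forall x : H, dot x x = `|x| ^+ 2)
    (sepH : separable_space H)
    (F : set H) (Fk : int -> set H)
    (F_indep : lin_indep F)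
    (F_overcomplete : is_overcomplete_frame dot F)
    (F_cover : F = \bigcup_k Fk k)
    (Fk_disjoint : trivIset [set: int] Fk)
    (Fk_nonempty : forall k : int, Fk k !=set0)
    (Fk_orth : forall (k1 k2 : int) (f f' : H), k1 != k2 ->
       Fk k1 f -> Fk k2 f' -> dot f (inverse (frame_operator dot F) f') = 0) :
  forall fn : int -> H, set_bij [set: int] F fn ->
    ~ exists T : {linear H -> H},
        GL T /\ forall n : int, fn n = zpower T n (fn 0).
Proof.
move=> fn [fnF fn_inj fn_surj] [T [[[M T_bounded] T_bij] fnT]].
have [frameF not_riesz] := F_overcomplete; apply: not_riesz.
set w := inverse (frame_operator dot F) in Fk_orth.
have wK : cancel w (frame_operator dot F).
  exact/inverse_surjK/(frame_operator_surjective dotE frameF).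
have T_inj := bij_inj T_bij.
have fnS n : T (fn n) = fn (n + 1).
  rewrite fnT [in RHS]fnT zpowerS//; apply: inverse_surjK => y.
  by have [S _ SK] := T_bij; exists (S y); exact: SK.
have TF u : F u -> F (T u) by move=> /fn_surj[n _ <-]; rewrite fnS; exact: fnF.
have TF_surj v : F v -> exists2 u, F u & T u = v.
  move=> /fn_surj[n _ <-]; exists (fn (n - 1)); first exact: fnF.
  by rewrite fnS subrK.
have coef_shift := @shift_invariantE _ (fun m n => dot (w (fn n)) (fn m)).
have {}coef_shift j m n :
    dot (w (fn (n + j))) (fn (m + j)) = dot (w (fn n)) (fn m).
  apply: coef_shift => {}m {}n; rewrite -!fnS; apply/esym.
  apply: (frame_coef_shift dotE frameF T_bounded) => //; first exact: fnF.
  by rewrite !wK.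
have /choice[k kP] n : exists k, Fk k (fn n).
  by have := fnF n I; rewrite F_cover => -[k _ kn]; exists k.
have k_surj m : exists j, k j = m.
  have [u Fmu] := Fk_nonempty m.
  have : F u by rewrite F_cover; exists m.
  move=> /fn_surj[j _ ju]; exists j; apply: Fk_disjoint => //.
  by exists u; split=> //; rewrite -ju.
have block m n : k m != k n -> dot (fn m) (w (fn n)) = 0.
  by move=> kmn; apply: Fk_orth kmn (kP m) (kP n).
apply: (orthogonal_dual_riesz dotE frameF (w := w)) => [u|u _|u v].
- exact: lin_indep_neq0.
- exact: wK.
move=> /fn_surj[m _ <-] /fn_surj[n _ <-] mn.
have [//|/eqP cmn] := pselect (dot (fn m) (w (fn n)) = 0); exfalso.
(* A nonzero entry at distance n - m makes the block number periodic. *)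
have d0 : n - m != 0 by rewrite subr_eq0; apply: contraNneq mn => ->.
apply: (periodic_not_surjective d0 _ k_surj) => j; apply/eqP.
apply: contraNT cmn; rewrite eq_sym => /block jn.
rewrite dotC -(coef_shift (j - m)).
rewrite (_ : m + (j - m) = j); last by rewrite addrC subrK.
rewrite (_ : n + (j - m) = j + (n - m)); last by ring.
by rewrite -dotC jn.
Qed.
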